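(* For every integer $n\ge 1$, $$v_3(\mathbf G_n(3))=\begin{cases}0,& n\equiv 0\pmod 4,\\ 1+v_3(n),& n\equiv 1\pmod 4,\\ 2+v_3(n)+v_3(n-1),& n\equiv 2\pmod 4,\\ 2+v_3(n)+v_3(n-1)+v_3(n-2),& n\equiv 3\pmod 4.\end{cases}$$ Equivalently, if $n=4Q+r$ with $Q$ an integer and $0\le r\le 3$, then $$v_3(\mathbf G_n(3))=r+v_3\binom nr.$$
   Context: Here $i^2=-1$ and $\mathbf G_n(3)=\sum_{a=1}^{2}\sum_{b=1}^{2}(a+bi)^n\in\mathbb Z[i]$. For $x+yi\in\mathbb Z[i]$, $v_3(x+yi)=\min\{v_3(x),v_3(y)\}$, where $v_3$ on integers is the usual $3$-adic valuation ($v_3(0)=\infty$). *)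

(* Defs.v *)
(* Mathematical Components, with real-closed for the pairs [x +i* y] and
   constructive_ereal for integers extended by +oo. *)
From HB Require Import structures.
From mathcomp Require Import all_boot all_order all_algebra.
From mathcomp Require Import complex constructive_ereal.

Set Implicit Arguments.
Unset Strict Implicit.
Unset Printing Implicit Defensive.

Import Order.TTheory GRing.Theory Num.Theory.

Local Open Scope ring_scope.

(* The library makes [complex R] a ring only when R is a field, so Z[i] is an
   alias of [complex int] given the library's addition and multiplication. *)
Definition gaussint : Type := complex int.

HB.instance Definition _ := GRing.Zmodule.on gaussint.

Fact gaussint_mul1 :
  left_id (Complex 1 0) (@ComplexField.mulc int).
Proof. by case=> a b; rewrite /= !mul1r !mul0r subr0 addr0. Qed.

Fact gaussint_mulDl :
  left_distributive (@ComplexField.mulc int) (@ComplexField.addc int).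
Proof.
case=> [a b] [c d] [e f]; rewrite /= !mulrDl !opprD -!addrA.
by congr (Complex (_ + _) (_ + _)); rewrite addrCA.
Qed.

Fact gaussint_one_neq0 : Complex 1 0 != 0 :> gaussint.
Proof. by rewrite eq_complex. Qed.

HB.instance Definition _ := GRing.Zmodule_isComNzRing.Build gaussint
  (@ComplexField.mulcA int) (@ComplexField.mulcC int)
  gaussint_mul1 gaussint_mulDl gaussint_one_neq0.

Definition gauss (x y : int) : gaussint := Complex x y.

Definition G3 (n : nat) : gaussint :=
  \sum_(1 <= a < 3) \sum_(1 <= b < 3) gauss a%:Z b%:Z ^+ n.

(* [logn 3 0] is 0, hence the separate treatment of 0. *)
Definition v3 (x : int) : \bar int :=
  if x == 0 then +oo%E else (logn 3 `|x|%N)%:Z%:E.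

Definition v3i (z : gaussint) : \bar int :=
  let: Complex x y := z in Order.min (v3 x) (v3 y).

(* Main.v *)
Require Import Defs.
From HB Require Import structures.
From mathcomp Require Import all_boot all_order all_algebra.
From mathcomp Require Import complex constructive_ereal.
From mathcomp Require Import zify ring.

Set Implicit Arguments.
Unset Strict Implicit.
Unset Printing Implicit Defensive.

Import Order.TTheory GRing.Theory Num.Theory.

Local Open Scope ring_scope.

(** Put u = 1 - i.  The four bases 2+2i, 1+2i, 1+i, 2+i are the corners of a
    unit square with centre 3(1+i)/2, and u turns that square into
    3 + i^k for k = 0, 1, 2, 3.  Hence, by the binomial formula and the
    vanishing of the sums of powers of i,

      u^n G_n = sum_k (3 + i^k)^n = 4 N,
      N = sum of C(n,j) 3^j over the j <= n with j = n mod 4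

    ([G3_binsum]).  Since u has norm 2, multiplying by u does not change
    divisibility by an odd integer, so the valuation of G_n is that of the
    natural number N.

    Let r = n mod 4.  In N the lowest term C(n,r) 3^r dominates.  For
    j = r + d with d a positive multiple of 4,

      C(n,j) C(j,r) = C(n,r) C(n-r,d),

    so going from r to j loses at most v_3(C(j,r)) in the binomial
    coefficient and gains d in the power of 3; and
    C(r+d,r) <= 2^(d+2) < 3^d, so v_3(C(j,r)) < d ([logn_bin_lt],
    [binsum_tail_dvd]).  Thus v_3(G_n) = r + v_3(C(n,r)) ([v3i_G3]), and the
    four explicit cases come from C(n,r) r! = n(n-1)...(n-r+1), where r! has
    valuation 1 for r = 3 and 0 for r < 3. *)

Lemma le_v3 (k : nat) (x : int) :
  (k%:Z%:E <= v3 x)%E = ((3 ^ k)%N%:Z %| x)%Z.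
Proof.
rewrite /v3; have [->|x0] := eqVneq; first by rewrite leey dvdz0.
by rewrite lee_fin lez_nat dvdzE /= pfactor_dvdn // absz_gt0.
Qed.

Definition dvdgauss (m : nat) (z : gaussint) : bool :=
  let: Complex x y := z in (m%:Z %| x)%Z && (m%:Z %| y)%Z.

(** Valuations of Gaussian integers are only ever computed through
    divisibility, which spares the case distinctions between zero and nonzero
    coordinates. *)
Lemma v3i_eq (c : nat) (z : gaussint) :
  dvdgauss (3 ^ c) z -> ~~ dvdgauss (3 ^ c.+1) z -> v3i z = c%:Z%:E.
Proof.
case: z => x y /=; rewrite -!le_v3 -!le_min.
have : Order.min (v3 x) (v3 y) = +oo%E \/
       exists k : nat, Order.min (v3 x) (v3 y) = k%:Z%:E.
  have v3_cases t : v3 t = +oo%E \/ exists k : nat, v3 t = k%:Z%:E.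
    by rewrite /v3; case: eqP => _; [left | right; eexists].
  by rewrite minEle; case: ifP.
case=> [->|[k ->]]; first by rewrite !leey.
by rewrite !lee_fin !lez_nat -ltnNge ltnS => ck kc; rewrite (_ : k = c) //; lia.
Qed.

(** The coordinates of (1 - i)(x + yi) are x + y and y - x, whose sum and
    difference are 2y and 2x; an odd m can cancel the 2. *)
Lemma dvdgauss_mul1Bi (m : nat) (z : gaussint) :
  odd m -> dvdgauss m (gauss 1 (- 1) * z) = dvdgauss m z.
Proof.
case: z => x y modd /=; rewrite !mul1r !mulN1r opprK.
have co : coprimez m%:Z 2 by rewrite coprimezE /= coprimen2.
apply/andP/andP => [[Dxy Dyx]|[Dx Dy]]; last by rewrite rpredD ?rpredB.
split; rewrite -(Gauss_dvdzr _ co).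
  by have := rpredB Dxy Dyx; rewrite (_ : _ - _ = 2 * x) //; ring.
by have := rpredD Dxy Dyx; rewrite (_ : _ + _ = 2 * y) //; ring.
Qed.

Lemma dvdgauss_exp1Bi (m n : nat) (z : gaussint) :
  odd m -> dvdgauss m (gauss 1 (- 1) ^+ n * z) = dvdgauss m z.
Proof.
move=> modd; elim: n => [|n IHn]; first by rewrite expr0 mul1r.
by rewrite exprS -mulrA dvdgauss_mul1Bi.
Qed.

Lemma natr_gauss (n : nat) : n%:R = gauss n%:Z 0 :> gaussint.
Proof. by elim: n => // n IHn; rewrite mulrS IHn intS. Qed.

Lemma dvdgauss_nat (m n : nat) : dvdgauss m n%:R = (m %| n)%N.
Proof. by rewrite natr_gauss /= dvdz0 andbT. Qed.

(** Orthogonality of the characters of Z/4, with values in the powers of i. *)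
Lemma sum_powers_i (m : nat) :
  \sum_(k < 4) (gauss 0 1 ^+ k) ^+ m = ((4 %| m)%N * 4)%:R.
Proof.
have i4 : gauss 0 1 ^+ 4 = 1 by [].
transitivity (\sum_(k < 4) (gauss 0 1 ^+ k) ^+ (m %% 4)%N).
  apply: eq_bigr => k _; rewrite {1}(divn_eq m 4) exprD mulnC exprM.
  by rewrite (exprAC _ k 4) i4 !expr1n mul1r.
rewrite /dvdn; have := ltn_pmod m (isT : (0 < 4)%N).
(* In each of the four residue classes both sides are closed terms. *)
by case: (m %% 4)%N => [|[|[|[|]]]] // _; rewrite !big_ord_recr big_ord0;
  apply/eqP.
Qed.

(** A quarter of the sum of the (3 + i^k)^n over k = 0, 1, 2, 3. *)
Definition binsum (n : nat) : nat :=
  \sum_(j < n.+1 | (4 %| n - j)%N) 'C(n, j) * 3 ^ j.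

Lemma G3_binsum (n : nat) :
  gauss 1 (- 1) ^+ n * G3 n = (4 * binsum n)%:R.
Proof.
transitivity (\sum_(k < 4) (gauss 0 1 ^+ k + 3%:R) ^+ n).
  have sum12 (f : nat -> gaussint) : \sum_(1 <= a < 3) f a = f 1%N + f 2%N.
    by rewrite big_ltn // big_nat1.
  rewrite /G3 !sum12 !mulrDr -!exprMn.
  rewrite !big_ord_recr big_ord0 /= add0r.
  (* Multiplication by 1 - i matches the corners with the points 3 + i^k. *)
  have -> : gauss 1 (- 1) * gauss 1 1 = gauss 0 1 ^+ 2 + 3%:R by apply/eqP.
  have -> : gauss 1 (- 1) * gauss 1 2 = gauss 0 1 ^+ 1 + 3%:R by apply/eqP.
  have -> : gauss 1 (- 1) * gauss 2 1 = gauss 0 1 ^+ 3 + 3%:R by apply/eqP.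
  have -> : gauss 1 (- 1) * gauss 2 2 = gauss 0 1 ^+ 0 + 3%:R by apply/eqP.
  by ring.
under eq_bigr do rewrite exprDn.
rewrite exchange_big /= /binsum mulnC big_distrl /= [in RHS]big_mkcond natr_sum.
apply: eq_bigr => j _; rewrite sumrMnl -mulr_suml sum_powers_i.
rewrite -natrX -natrM -mulrnA; congr (_%:R).
by case: ifP => _; lia.
Qed.

(** The exponent m, rather than m + 1, is needed below: with d = 4 and r = 3
    the bound for C(7,3) is 2^6 = 64 < 3^4, whereas 2^7 would exceed 3^4. *)
Lemma leq_bin_exp2 (m r : nat) : ('C(m.+1, r) <= 2 ^ m)%N.
Proof.
elim: m r => [|m IHm] [|r] //=; rewrite ?bin0 ?expn_gt0 //.
  by case: r.
by rewrite binS expnS mul2n -addnn leq_add.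
Qed.

Lemma exp2_lt_exp3 (d : nat) : (4 <= d)%N -> (2 ^ d.+2 < 3 ^ d)%N.
Proof.
move=> /subnKC <-; elim: (d - 4)%N => // e IHe.
by rewrite addnS expnS [(3 ^ _)%N]expnS; lia.
Qed.

(** A size argument suffices: the binomial coefficient is below 3^d. *)
Lemma logn_bin_lt (d r : nat) : (r <= 3)%N -> (4 <= d)%N ->
  (logn 3 'C(r + d, r) < d)%N.
Proof.
move=> r3 d4; rewrite -(@ltn_exp2l 3) //.
apply: leq_ltn_trans (exp2_lt_exp3 d4).
have C0 : (0 < 'C(r + d, r))%N by rewrite bin_gt0 leq_addr.
apply: leq_trans (dvdn_leq C0 (pfactor_dvdnn _ _)) _.
rewrite -(ltn_predK (leq_trans d4 (leq_addl r d))).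
apply: leq_trans (leq_bin_exp2 _ _) _.
by rewrite leq_exp2l //; lia.
Qed.

(** Both sides count the ways to pick disjoint sets of sizes r and d among n
    elements. *)
Lemma mul_bin_trinomial (n r d : nat) : (r + d <= n)%N ->
  ('C(n, r + d) * 'C(r + d, r) = 'C(n, r) * 'C(n - r, d))%N.
Proof.
move=> le_n; have F0 : (0 < r`! * d`! * (n - (r + d))`!)%N.
  by rewrite !muln_gt0 !fact_gt0.
apply/eqP; rewrite -(eqn_pmul2r F0); apply/eqP; transitivity n`!.
  by rewrite -(bin_fact le_n) -(bin_fact (leq_addr d r)) addKn; ring.
rewrite -(@bin_fact n r); last by lia.
by rewrite -(@bin_fact (n - r) d) ?subnDA; [ring | lia].
Qed.

(** The trinomial identity bounds from below the valuation of C(n,r+d) by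
    v_3(C(n,r)) - v_3(C(r+d,r)), and the loss is less than the gain d from the
    power of 3. *)
Lemma binsum_tail_dvd (n r d : nat) :
  (r <= 3)%N -> (4 <= d)%N -> (r + d <= n)%N ->
  (3 ^ (r + logn 3 'C(n, r)).+1 %| 'C(n, r + d) * 3 ^ (r + d))%N.
Proof.
move=> r3 d4 le_n.
have C0 : (0 < 'C(n, r + d))%N by rewrite bin_gt0.
rewrite pfactor_dvdn ?muln_gt0 ?C0 ?expn_gt0 // lognM ?expn_gt0 // pfactorK //.
have := congr1 (logn 3) (mul_bin_trinomial le_n).
rewrite !lognM ?bin_gt0 ?leq_addr //; try lia.
by have := logn_bin_lt r3 d4; lia.
Qed.

(** Modulo one power of 3 more than the valuation of its lowest term, the sum
    reduces to that term; divisibility by any 3^k up to that power is thus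
    decided by the lowest term alone. *)
Lemma dvdn_binsum (n k : nat) :
  let r := (n %% 4)%N in (k <= (r + logn 3 'C(n, r)).+1)%N ->
  (3 ^ k %| binsum n)%N = (k <= r + logn 3 'C(n, r))%N.
Proof.
move=> r le_k.
have r3 : (r <= 3)%N by rewrite -ltnS ltn_pmod.
have rn : (r < n.+1)%N by rewrite ltnS leq_mod.
have C0 : (0 < 'C(n, r))%N by rewrite bin_gt0.
rewrite /binsum (bigD1 (Ordinal rn)) /=; last by rewrite /r; lia.
rewrite dvdn_addl.
  rewrite pfactor_dvdn ?muln_gt0 ?C0 ?expn_gt0 // lognM ?expn_gt0 //.
  by rewrite pfactorK // addnC.
apply: dvdn_sum => j /andP [dvd_j ne_j].
have {}ne_j : nat_of_ord j != r by [].
have le_j := ltn_ord j.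
have -> : nat_of_ord j = (r + (j - r))%N by rewrite /r in ne_j *; lia.
apply: dvdn_trans (dvdn_exp2l 3 le_k) (binsum_tail_dvd r3 _ _);
  by rewrite /r in ne_j *; lia.
Qed.

Lemma v3i_G3 (n : nat) (r := (n %% 4)%N) :
  v3i (G3 n) = (r + logn 3 'C(n, r))%N%:Z%:E.
Proof.
have dvdG k : dvdgauss (3 ^ k) (G3 n) = (3 ^ k %| binsum n)%N.
  rewrite -(@dvdgauss_exp1Bi _ n) ?oddX ?orbT // G3_binsum dvdgauss_nat.
  by rewrite Gauss_dvdr // coprimeXl.
by apply: v3i_eq; rewrite dvdG dvdn_binsum // ltnn.
Qed.

Lemma v3_nat (m : nat) : (0 < m)%N -> v3 m%:Z = (logn 3 m)%:Z%:E.
Proof. by case: m. Qed.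

Lemma logn3_ffact (n r : nat) : (r <= n)%N ->
  (logn 3 'C(n, r) + logn 3 r`! = \sum_(i < r) logn 3 (n - i))%N.
Proof.
move=> le_rn; rewrite -lognM ?bin_gt0 ?fact_gt0 // bin_ffact.
elim: r le_rn => [|r IHr] lt_rn; first by rewrite ffactn0 big_ord0.
rewrite ffactnSr big_ord_recr /= -IHr 1?ltnW // lognM ?subn_gt0 //.
by rewrite ffact_gt0 ltnW.
Qed.

Theorem theorem8 (n : nat) (n_ge1 : (1 <= n)%N) :
  [/\ (n = 0 %[mod 4])%N -> v3i (G3 n) = 0%:E,
      (n = 1 %[mod 4])%N -> v3i (G3 n) = (1%:E + v3 n%:Z)%E,
      (n = 2 %[mod 4])%N ->
        v3i (G3 n) = (2%:E + v3 n%:Z + v3 (n%:Z - 1))%E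
    & (n = 3 %[mod 4])%N ->
        v3i (G3 n) = (2%:E + v3 n%:Z + v3 (n%:Z - 1) + v3 (n%:Z - 2))%E]
  /\ (forall (Q : int) (r : nat),
        n%:Z = 4 * Q + r%:Z -> (r <= 3)%N ->
        v3i (G3 n) = (r%:Z%:E + v3 'C(n, r)%:Z)%E).
Proof.
split; last first.
  move=> Q r nE r3; rewrite v3i_G3.
  have -> : (n %% 4)%N = r by lia.
  by rewrite v3_nat ?bin_gt0 -?EFinD ?PoszD //; lia.
split=> nE; rewrite v3i_G3 nE modn_small //.
- by rewrite bin0.
- by rewrite bin1 v3_nat.
- have := @logn3_ffact n 2 ltac:(lia).
  rewrite !big_ord_recr big_ord0 /= subn0 (_ : logn 3 2`! = 0)%N //.
  rewrite (_ : n%:Z - 1 = (n - 1)%N%:Z); last lia.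
  rewrite !v3_nat -?EFinD; try lia.
  by move=> E; congr (_%:E); lia.
- have := @logn3_ffact n 3 ltac:(lia).
  rewrite !big_ord_recr big_ord0 /= subn0 (_ : logn 3 3`! = 1)%N //.
  rewrite (_ : n%:Z - 1 = (n - 1)%N%:Z); last lia.
  rewrite (_ : n%:Z - 2 = (n - 2)%N%:Z); last lia.
  rewrite !v3_nat -?EFinD; try lia.
  by move=> E; congr (_%:E); lia.
Qed.
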